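(* Let $\mathcal M(q)$ be a finite Möbius plane of order $q$ and let $S$ be a split-resolving set of minimum cardinality of its point-circle incidence graph. Then \[5q-10\le|S|\le\frac{q+2}{2}\left(1+\log\left(q^5\right)\right)+2q-2.\]
   Context: A Möbius plane is a pair $(\mathcal P,\mathcal Z)$, where $\mathcal P$ is a set (of points) and $\mathcal Z$ is a set of subsets of $\mathcal P$ (circles), such that: (i) any three pairwise distinct points lie on exactly one circle; (ii) if $z\in\mathcal Z$, $P\in z$ and $Q\in\mathcal P\setminus z$, there is exactly one circle $z'$ through $P$ and $Q$ with $z\cap z'=\{P\}$; (iii) there is at least one circle and every circle has at least three points; (iv) for every circle $z$ there is a point not on $z$. It is finite if $\mathcal P$ is finite; then all circles have the same number $q+1$ of points, and $q$ is the order. The point-circle incidence graph has vertex set $\mathcal P\cup\mathcal Z$ and edges $\{P,z\}$ with $P\in z$, with shortest-path distance $d$. A set $S$ resolves $W$ if for any two distinct $u,v\in W$ there is $s\in S$ with $d(u,s)\ne d(v,s)$. A set $S\subseteq\mathcal P\cup\mathcal Z$ is split-resolving if $S\cap\mathcal P$ resolves $\mathcal Z$ and $S\cap\mathcal Z$ resolves $\mathcal P$. Here $\log$ is the natural logarithm. *)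

(* Defs.v *)
From HB Require Import structures.
From mathcomp Require Import all_boot all_order all_algebra.

Set Implicit Arguments.
Unset Strict Implicit.
Unset Printing Implicit Defensive.

Section GraphDistance.
Variables (T : finType) (e : rel T).

(* The length of a shortest path from u to v. A shortest path has fewer than
   #|T| edges; if u and v are not connected, the value is #|T|, which exceeds
   every actual distance. *)
Definition gdist (u v : T) : nat :=
  find (fun n => [exists p : n.-tuple T, path e u p && (last u p == v)])
       (iota 0 #|T|).

Definition resolves (S W : {set T}) : Prop :=
  forall u v, u \in W -> v \in W -> u != v ->
    exists2 s, s \in S & gdist u s != gdist v s.

End GraphDistance.

Record mobius_plane (P : finType) (Z : {set {set P}}) : Prop := MobiusPlane {
  mobius_circle3 : forall A B C : P, A != B -> A != C -> B != C ->
    exists! z : {set P}, [/\ z \in Z, A \in z, B \in z & C \in z];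
  mobius_tangent : forall (z : {set P}) (A B : P),
    z \in Z -> A \in z -> B \notin z ->
    exists! z' : {set P},
      [/\ z' \in Z, A \in z', B \in z' & z :&: z' = [set A]];
  mobius_has_circle : exists z : {set P}, z \in Z;
  mobius_circle_card : forall z : {set P}, z \in Z -> 3 <= #|z|;
  mobius_off_circle : forall z : {set P}, z \in Z -> exists A : P, A \notin z
}.

Definition mobius_plane_of_order (P : finType) (Z : {set {set P}}) (q : nat) :
    Prop :=
  mobius_plane Z /\ forall z : {set P}, z \in Z -> #|z| = q.+1.

Section IncidenceGraph.
Variables (P : finType) (Z : {set {set P}}).

Definition vertex : finType := (P + {z : {set P} | z \in Z})%type.

Definition incidence : rel vertex := fun u v =>
  match u, v with
  | inl A, inr z => A \in val z
  | inr z, inl A => A \in val z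
  | _, _ => false
  end.

Definition point_vertices : {set vertex} :=
  [set v : vertex | if v is inl _ then true else false].

Definition circle_vertices : {set vertex} :=
  [set v : vertex | if v is inr _ then true else false].

Definition split_resolving (S : {set vertex}) : Prop :=
  resolves incidence (S :&: point_vertices) circle_vertices /\
  resolves incidence (S :&: circle_vertices) point_vertices.

Definition min_split_resolving (S : {set vertex}) : Prop :=
  split_resolving S /\
  forall S' : {set vertex}, split_resolving S' -> #|S| <= #|S'|.

End IncidenceGraph.

(* Main.v *)
Require Import Defs.
From HB Require Import structures.
From mathcomp Require Import all_boot all_order all_algebra.
From mathcomp Require Import reals exp.
From mathcomp Require Import zify ring lra.

Set Implicit Arguments.
Unset Strict Implicit.
Unset Printing Implicit Defensive.

Import Order.TTheory GRing.Theory Num.Theory.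

(** A point and a circle are at distance 1 or 3 according to incidence, so a
    split-resolving set is a set [A] of points on which distinct circles have
    distinct traces, together with a set [F] of circles such that distinct
    points lie on distinct subfamilies of [F].

    Lower bound: at most [C(n,0)], [C(n,1)], [C(n,2)] circles have a trace of
    size 0, 1, 2 on [A], where [n = #|A|], so double counting incidences gives
    [3 #|Z| <= n q (q+1) + 3 + 2n + C(n,2)], whence [n >= 3q - 7]. Likewise
    [2 #|P| <= (q+1) #|F| + 2 + #|F|], whence [#|F| >= 2q - 3].

    Upper bound: in the affine plane derived at a point, two parallel classes of
    lines minus one line each resolve the points (if [q > 2]) with [2q - 2]
    circles. The set [A] has to meet the symmetric differences of all pairs of
    circles; these have at least [2q - 2] points and a point lies in at most
    [q^5 - q^3] of them, so the greedy (Stein-Lovasz) bound applies. For [q = 2]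
    all 5 points and 3 circles suffice. *)

(** * Double counting of incidences *)

Lemma double_count (I J : finType) (A : {set I}) (B : {set J})
    (r : I -> J -> bool) :
  \sum_(x in A) #|[set y in B | r x y]| = \sum_(y in B) #|[set x in A | r x y]|.
Proof.
under eq_bigr do rewrite -sum1dep_card big_mkcondr /=.
rewrite exchange_big /=.
by apply: eq_bigr => y _; rewrite -big_mkcondr sum1dep_card.
Qed.

Lemma card_singleton (T : finType) (F : {set T}) w :
  w \in F -> (forall z, z \in F -> z = w) -> #|F| = 1.
Proof.
move=> wF h; rewrite (_ : F = [set w]) ?cards1 //.
by apply/setP => z; rewrite inE; apply/idP/eqP => [/h|->].
Qed.

(** * Greedy covers of hypergraphs *)

Section Greedy.
Local Open Scope ring_scope.

Lemma cover_edges_le (T : finType) (k d : nat) (E : {set {set T}}) :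
  (forall e, e \in E -> k <= #|e|)%N ->
  (forall x, #|[set e in E | x \in e]| <= d)%N ->
  (#|E| * k <= #|T| * d)%N.
Proof.
move=> hk hd.
have := double_count E [set: T] (fun e x => x \in e).
have -> : (\sum_(e in E) #|[set x in [set: T] | x \in e]| = \sum_(e in E) #|e|)%N.
  by apply: eq_bigr => e _; apply: eq_card => x; rewrite !inE.
move=> eq_count; rewrite -sum_nat_const.
apply: (@leq_trans (\sum_(e in E) #|e|)%N); first exact: leq_sum.
rewrite eq_count -cardsT -sum_nat_const.
by apply: leq_sum.
Qed.

(** This is [ln y <= y - 1] at [y = d / (d + 1)]. Summed over degrees, it turns the harmonic sum of
    the greedy bound into a logarithm. *)
Lemma ln_succ_diff (R : realType) (d : nat) : (0 < d)%N ->
  d.+1%:R^-1 <= ln (d.+1%:R) - ln (d%:R) :> R.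
Proof.
move=> d0.
have d0' : 0 < d%:R :> R by rewrite ltr0n.
have D0 : 0 < d.+1%:R :> R by rewrite ltr0n.
have h : ln (d%:R / d.+1%:R) <= d%:R / d.+1%:R - 1 :> R.
  have := divr_gt0 d0' D0; set y := _ / _ => y0.
  have -> : y = 1 + (y - 1) by ring.
  apply: le_trans (le_ln1Dx _) _; last by lra.
  by lra.
rewrite ln_div ?posrE // in h.
have e : d%:R / d.+1%:R - 1 = - d.+1%:R^-1 :> R.
  by rewrite -[d.+1%:R]natr1; field; rewrite natr1 gt_eqF.
by rewrite e in h; move: h; set y := _^-1; set a := ln _; set b := ln _; lra.
Qed.

(* Taking a point of maximal degree d removes d edges; once all degrees drop
   below d, the loss in the first term is at most (#|T| / k) / d. *)
Lemma greedy_cover (R : realType) (T : finType) (k d : nat) (E : {set {set T}}) :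
  (0 < k)%N -> (0 < d)%N ->
  (forall e, e \in E -> k <= #|e|)%N ->
  (forall x, #|[set e in E | x \in e]| <= d)%N ->
  exists2 C : {set T}, (forall e, e \in E -> exists2 x, x \in C & x \in e) &
    #|C|%:R <= #|E|%:R / d%:R + #|T|%:R / k%:R * ln d%:R :> R.
Proof.
(* The measure [d + #|E|] decreases both when a chosen point removes [d] edges and when the degree
   bound drops by one. *)
move=> k0; have [n] := ubnP (d + #|E|).
elim: n => // n IHn in d E * => ltn d0 hk hd.
case: (pickP (fun x => #|[set e in E | x \in e]| == d)) => [x /eqP dx | small].
  set Ex := [set e in E | x \in e] in dx.
  have sEx : Ex \subset E by apply/subsetP => e; rewrite inE => /andP[].
  have cE : #|E| = (d + #|E :\: Ex|)%N.
    by rewrite -dx -(cardsID Ex E) (setIidPr sEx).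
  have [||||C hC leC] := IHn d (E :\: Ex); rewrite ?d0 //.
  - by lia.
  - by move=> e /setDP[/hk].
  - move=> y; apply: leq_trans (hd y); apply/subset_leq_card/subsetP => e.
    by rewrite !inE => /andP[/andP[_ ->]].
  exists (x |: C) => [e eE|].
    case xe: (x \in e); first by exists x; rewrite // setU11.
    have [|y yC ye] := hC e; first by rewrite !inE eE xe.
    by exists y => //; rewrite in_setU1 yC orbT.
  have d0' : d%:R != 0 :> R by rewrite pnatr_eq0 -lt0n.
  apply: (@le_trans _ _ (1 + #|C|%:R)).
    by rewrite -(natrD R 1) ler_nat cardsU1; case: (_ \notin _).
  by rewrite cE natrD mulrDl divff // -addrA lerD2l.
have hd' x : (#|[set e in E | x \in e]| <= d.-1)%N.
  by have := hd x; have := small x => /= /negbT; lia.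
case: d => [//|[|d]] in d0 hk hd small hd' ltn *.
  (* The degree bound is 1 and no point attains it, so no point lies on an edge; edges are nonempty
     since [0 < k], hence there are none. *)
  have E0 : E = set0.
    apply/setP => e; rewrite in_set0; apply/negP => eE.
    have /card_gt0P[x xe] : (0 < #|e|)%N by apply: leq_trans k0 (hk _ eE).
    have : (0 < #|[set e in E | x \in e]|)%N.
      by apply/card_gt0P; exists e; rewrite inE eE.
    by have := hd' x; lia.
  exists set0 => [e|]; first by rewrite E0 inE.
  by rewrite E0 !cards0 ln1; lra.
have [||||C hC leC] := IHn d.+1 E => //.
exists C => //; apply: le_trans leC _.
have := cover_edges_le hk hd'; rewrite /= -(ler_nat R) !natrM => hm.
have := @ln_succ_diff R d.+1 isT; set a := ln _; set b := ln _ => hl.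
have K0 : 0 < k%:R :> R by rewrite ltr0n.
have D1 : 0 < d.+1%:R :> R by rewrite ltr0n.
have D2 : 0 < d.+2%:R :> R by rewrite ltr0n.
have eD : d.+2%:R = d.+1%:R + 1 :> R by rewrite natr1.
have h1 : #|E|%:R / d.+1%:R <= #|T|%:R / k%:R :> R.
  by rewrite ler_pdivrMr // mulrAC ler_pdivlMr.
have h2 : #|E|%:R / d.+1%:R - #|E|%:R / d.+2%:R = #|E|%:R / d.+1%:R * d.+2%:R^-1 :> R.
  rewrite eD; move: (d.+1%:R) D1 => x x0; field.
  by rewrite !lt0r_neq0 // addr_gt0.
have h3 : #|E|%:R / d.+1%:R * d.+2%:R^-1 <= #|T|%:R / k%:R * (a - b) :> R.
  apply: ler_pM => //; last by rewrite invr_ge0 ltW.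
  by rewrite divr_ge0 // ltW.
rewrite -h2 mulrBr in h3; move: h3.
move: (_ / d.+1%:R) (_ / d.+2%:R) (_ * a) (_ * b) => u v s t; lra.
Qed.

End Greedy.

(** * Parameters of a finite Möbius plane *)

Section Mobius.
Variables (P : finType) (Z : {set {set P}}) (q : nat).
Hypothesis hM : mobius_plane_of_order Z q.
Let hMP : mobius_plane Z := hM.1.
Let card_circle : forall z, z \in Z -> #|z| = q.+1 := hM.2.

Lemma order_gt1 : 1 < q.
Proof.
have [z zZ] := mobius_has_circle hMP.
by have := mobius_circle_card hMP zZ; rewrite card_circle.
Qed.

Lemma circle_uniq z w A B C : z \in Z -> w \in Z ->
  A != B -> A != C -> B != C ->
  A \in z -> B \in z -> C \in z -> A \in w -> B \in w -> C \in w -> z = w.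
Proof.
move=> zZ wZ AB AC BC Az Bz Cz Aw Bw Cw.
have [u [_ uniq_u]] := mobius_circle3 hMP AB AC BC.
by rewrite -(uniq_u z) ?(uniq_u w).
Qed.

Lemma card_circleI z w : z \in Z -> w \in Z -> z != w -> #|z :&: w| <= 2.
Proof.
move=> zZ wZ; apply: contra_neqT; rewrite -ltnNge => /card_gt2P.
case=> A [B [C [[/setIP[Az Aw] /setIP[Bz Bw] /setIP[Cz Cw]] [AB BC CA]]]].
by apply: (circle_uniq zZ wZ AB _ BC) => //; rewrite eq_sym.
Qed.

Lemma exists_third_point (A B : P) : exists C, (C != A) && (C != B).
Proof.
have [z zZ] := mobius_has_circle hMP.
have h : 2 < #|z| by rewrite card_circle // ltnS order_gt1.
have : 0 < #|z :\: [set A; B]|.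
  rewrite cardsD; have := subset_leq_card (subsetIr z [set A; B]).
  by rewrite cards2; lia.
by case/card_gt0P => C; rewrite !inE negb_or => /andP[h' _]; exists C.
Qed.

Lemma exists_circle3 (A B C : P) : A != B -> A != C -> B != C ->
  exists z, [/\ z \in Z, A \in z, B \in z & C \in z].
Proof.
by move=> AB AC BC; have [z [hz _]] := mobius_circle3 hMP AB AC BC; exists z.
Qed.

Lemma exists_circle_avoiding A B : A != B ->
  exists z, [/\ z \in Z, A \in z & B \notin z].
Proof.
move=> AB; have [C /andP[CA CB]] := exists_third_point A B.
rewrite eq_sym in CA; rewrite eq_sym in CB.
have [z [zZ Az Bz Cz]] := exists_circle3 AB CA CB.
have [D Dz] := mobius_off_circle hMP zZ.
have AD : A != D by apply: contraNneq Dz => <-.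
have CD : C != D by apply: contraNneq Dz => <-.
have [w [wZ Aw Cw Dw]] := exists_circle3 CA AD CD.
exists w; split=> //; apply: contraNN Dz => Bw.
by rewrite (circle_uniq zZ wZ AB CA CB).
Qed.

(** Fix a circle [z0] through [A] but not [B]. Apart from the tangent [t] to [z0] at [A], each
    circle through [A] and [B] meets [z0] in exactly one further point, and each of the [q] further
    points of [z0] arises once. *)
Lemma card_circles_through2 A B : A != B ->
  #|[set z in Z | (A \in z) && (B \in z)]| = q.+1.
Proof.
move=> AB; have [z0 [z0Z Az0 Bz0]] := exists_circle_avoiding AB.
have [t [[tZ At Bt zt] uniq_t]] := mobius_tangent hMP z0Z Az0 Bz0.
pose F := [set z in Z | (A \in z) && (B \in z)].
have tF : t \in F by rewrite inE tZ At Bt.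
have zA C : C \in z0 :\ A -> #|[set z in F :\ t | C \in z]| = 1.
  case/setD1P => CA Cz0; rewrite eq_sym in CA.
  have BC : B != C by apply: contraNneq Bz0 => ->.
  have [w [wZ Aw Bw Cw]] := exists_circle3 AB CA BC.
  apply: (@card_singleton _ _ w).
    rewrite !inE wZ Aw Bw Cw !andbT; apply: contraNneq CA => wt.
    by have /set1P -> : C \in [set A] by rewrite -zt inE Cz0 -wt.
  move=> z; rewrite !inE => /andP[/andP[_ /and3P[zZ Az Bz]] Cz].
  exact: (circle_uniq zZ wZ AB CA BC).
have zF z : z \in F :\ t -> #|[set C in z0 :\ A | C \in z]| = 1.
  case/setD1P => zt'; rewrite inE => /and3P[zZ Az Bz].
  have zz0 : z0 != z by apply: contraNneq Bz0 => ->.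
  have -> : [set C in z0 :\ A | C \in z] = (z0 :&: z) :\ A.
    by apply/setP => C; rewrite !inE andbA.
  have AI : A \in z0 :&: z by rewrite inE Az0.
  have := card_circleI z0Z zZ zz0; rewrite (cardsD1 A) AI add1n ltnS => h.
  apply/eqP; rewrite eqn_leq h lt0n cards_eq0; apply: contraNN zt' => /eqP e.
  rewrite eq_sym; apply/eqP; apply: uniq_t; split=> //.
  by rewrite -(setD1K AI) e setU0.
have := double_count (z0 :\ A) (F :\ t) (fun C z => C \in z).
rewrite (eq_bigr _ zA) (eq_bigr _ zF) !sum1_card => h.
have := cardsD1 A z0; rewrite Az0 card_circle // add1n => -[cA].
by rewrite (cardsD1 t F) tF add1n -h cA.
Qed.

(** The [q + 1] circles through two fixed points partition the remaining points into blocks of size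
    [q - 1]. *)
Lemma card_points : #|P| = q ^ 2 + 1.
Proof.
have [z zZ] := mobius_has_circle hMP.
have : 1 < #|z| by rewrite card_circle // ltnW // ltnS order_gt1.
case/card_gt1P => A [B [_ _ AB]].
have := double_count (~: [set A; B]) [set z in Z | (A \in z) && (B \in z)]
  (fun C z => C \in z).
rewrite (eq_bigr (fun=> 1)); last first.
  move=> C; rewrite !inE negb_or => /andP[CA CB].
  rewrite eq_sym in CA; rewrite eq_sym in CB.
  have [w [wZ Aw Bw Cw]] := exists_circle3 AB CA CB.
  apply: (@card_singleton _ _ w); first by rewrite !inE wZ Aw Bw Cw.
  move=> u; rewrite !inE => /andP[/and3P[uZ Au Bu] Cu].
  exact: (circle_uniq uZ wZ AB CA CB).
rewrite [RHS](eq_bigr (fun=> q.-1)); last first.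
  move=> u; rewrite inE => /and3P[uZ Au Bu].
  rewrite (_ : [set _ in _ | _] = u :\: [set A; B]); last first.
    by apply/setP => C; rewrite !inE.
  rewrite cardsD (setIidPr _) ?cards2 ?AB ?card_circle; first by lia.
    by [].
  by apply/subsetP => C; rewrite !inE => /orP[]/eqP->.
rewrite sum1_card sum_nat_const card_circles_through2 // cardsCs setCK cards2 AB.
have := max_card [set A; B]; rewrite cards2 AB.
by have := order_gt1; case: q => // n; nia.
Qed.

Lemma card_circles_through A : #|[set z in Z | A \in z]| = q * q.+1.
Proof.
have := double_count (~: [set A]) [set z in Z | A \in z] (fun C z => C \in z).
rewrite (eq_bigr (fun=> q.+1)); last first.
  move=> C; rewrite !inE eq_sym => neqAC; rewrite -(card_circles_through2 neqAC).
  by apply: eq_card => z; rewrite !inE andbA.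
rewrite [RHS](eq_bigr (fun=> q)); last first.
  move=> u; rewrite inE => /andP[uZ Au].
  have := cardsD1 A u; rewrite Au card_circle // add1n => -[->].
  by apply: eq_card => C; rewrite !inE.
rewrite !sum_nat_const cardsC1 card_points addn1 /=.
by have := order_gt1; nia.
Qed.

Lemma card_circles : #|Z| = q * (q ^ 2 + 1).
Proof.
have := double_count [set: P] Z (fun C z => C \in z).
rewrite (eq_bigr (fun=> q * q.+1)) => [|A _]; last exact: card_circles_through.
rewrite [RHS](eq_bigr (fun=> q.+1)); last first.
  by move=> u uZ; rewrite -(card_circle uZ); apply: eq_card => C; rewrite !inE.
by rewrite !sum_nat_const cardsT card_points; nia.
Qed.

(** In the affine plane derived at [p], whose lines are the circles through [p], this is the
    parallel class of [z] when [p] lies on [z]; the first disjunct makes parallelism reflexive. *)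
Definition tangent_class (p : P) (z : {set P}) : {set {set P}} :=
  [set w in Z | (w == z) || (z :&: w == [set p])].

Lemma tangent_class_through p z w : w \in tangent_class p z -> p \in z -> p \in w.
Proof.
rewrite inE => /andP[_ /orP[/eqP->//|/eqP h _]].
by have /setIP[] : p \in z :&: w by rewrite h set11.
Qed.

(** Playfair's axiom in the derived plane. If [A] is off [z] it is the uniqueness of tangent
    circles; if [A] is on [z], a member through [A] shares [A] and [p] with [z] and so must be
    [z]. *)
Lemma tangent_class_uniq p z u w A : z \in Z -> p \in z -> A != p ->
  u \in tangent_class p z -> w \in tangent_class p z ->
  A \in u -> A \in w -> u = w.
Proof.
move=> zZ pz Ap uz wz Au Aw.
have pu := tangent_class_through uz pz; have pw := tangent_class_through wz pz.
have tangA v : A \in z -> v \in tangent_class p z -> A \in v -> v = z.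
  move=> Az; rewrite inE => /andP[_ /orP[/eqP//|/eqP h]] Av.
  have /set1P e : A \in [set p] by rewrite -h inE Az.
  by rewrite e eqxx in Ap.
case: (boolP (A \in z)) => Az; first by rewrite (tangA u) // (tangA w).
have [t [_ uniq_t]] := mobius_tangent hMP zZ pz Az.
have tangN v : v \in tangent_class p z -> A \in v -> t = v.
  move=> vz Av; apply: uniq_t; have pv := tangent_class_through vz pz.
  move: vz; rewrite inE => /andP[vZ /orP[/eqP e|/eqP h]]; last by split.
  by rewrite -e Av in Az.
by rewrite -(tangN u) // (tangN w).
Qed.

Lemma tangent_class_exists p z A : z \in Z -> p \in z ->
  exists2 w, w \in tangent_class p z & A \in w.
Proof.
move=> zZ pz; case: (boolP (A \in z)) => Az.
  by exists z => //; rewrite inE zZ eqxx.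
have [t [[tZ pt At zt] _]] := mobius_tangent hMP zZ pz Az.
by exists t => //; rewrite inE tZ zt eqxx orbT.
Qed.

Lemma tangent_class_sym p z w :
  z \in Z -> w \in tangent_class p z -> z \in tangent_class p w.
Proof. by move=> zZ; rewrite !inE zZ eq_sym setIC => /andP[_ ->]. Qed.

Lemma card_tangent_class p z : z \in Z -> p \in z -> #|tangent_class p z| = q.
Proof.
move=> zZ pz.
have := double_count (~: [set p]) (tangent_class p z) (fun C z => C \in z).
rewrite (eq_bigr (fun=> 1)); last first.
  move=> C; rewrite !inE => Cp.
  have [w wz Cw] := tangent_class_exists C zZ pz.
  apply: (@card_singleton _ _ w); first by rewrite inE wz.
  by move=> u; rewrite inE => /andP[uz Cu]; apply: (tangent_class_uniq zZ pz Cp).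
rewrite [RHS](eq_bigr (fun=> q)); last first.
  move=> u uz; have pu := tangent_class_through uz pz.
  have uZ : u \in Z by move: uz; rewrite inE => /andP[].
  have := cardsD1 p u; rewrite pu card_circle // add1n => -[->].
  by apply: eq_card => C; rewrite !inE.
rewrite !sum_nat_const cardsC1 card_points addn1 /=.
by have := order_gt1; nia.
Qed.

(** * Resolving the points by two parallel classes *)

Definition points_resolve (A : {set P}) :=
  forall z w, z \in Z -> w \in Z -> z != w ->
    exists2 a, a \in A & (a \in z) != (a \in w).

Definition circles_resolve (F : {set {set P}}) :=
  forall p p' : P, p != p' -> exists2 z, z \in F & (p \in z) != (p' \in z).

(* In the affine plane at p, two parallel classes are coordinates; one circle
   of each class may be dropped, since it is the common complement of the others. *)
Lemma coordinates_resolve p z w z0 w0 A :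
  z \in Z -> w \in Z -> p \in z -> p \in w -> z != w ->
  A != p -> A \in z -> A \in w ->
  1 < #|tangent_class p z :\ z0| ->
  circles_resolve ((tangent_class p z :\ z0) :|: (tangent_class p w :\ w0)).
Proof.
move=> zZ wZ pz pw zw Ap Az Aw card1.
(* If one member of a class separates [B] from [C], so does the member through the other point. With
   two separating members, one survives the removal of [v0]. *)
have separate v v0 B C : v \in Z -> p \in v -> B != p -> C != p ->
    (exists2 u, u \in tangent_class p v & (B \in u) != (C \in u)) ->
    exists2 u, u \in tangent_class p v :\ v0 & (B \in u) != (C \in u).
  move=> vZ pv Bp Cp [u uv neq].
  have [u' [u'v u'u neq']] : exists u',
      [/\ u' \in tangent_class p v, u' != u & (B \in u') != (C \in u')].
    case Bu: (B \in u) in neq; case Cu: (C \in u) in neq => //.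
      have [u' u'v Cu'] := tangent_class_exists C vZ pv.
      have uu' : u' != u by apply: contraFneq Cu => <-.
      exists u'; split=> //; rewrite Cu'; case Bu': (B \in u') => //.
      by rewrite (tangent_class_uniq vZ pv Bp u'v uv Bu' Bu) eqxx in uu'.
    have [u' u'v Bu'] := tangent_class_exists B vZ pv.
    have uu' : u' != u by apply: contraFneq Bu => <-.
    exists u'; split=> //; rewrite Bu'; case Cu': (C \in u') => //.
    by rewrite (tangent_class_uniq vZ pv Cp u'v uv Cu' Cu) eqxx in uu'.
  case: (eqVneq u v0) => [<-|uv0]; first by exists u'; rewrite // in_setD1 u'u.
  by exists u; rewrite // in_setD1 uv0.
(* Every member contains [p], so separating [B] from [p] takes a member that misses [B]. At most one
   member contains [B], so two remaining members are enough. *)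
have base B : B != p -> exists2 u, u \in tangent_class p z :\ z0 & B \notin u.
  move=> Bp; have /card_gt1P[u [u' [uz uz' uu']]] := card1.
  case: (boolP (B \in u)) => Bu; last by exists u.
  exists u' => //; apply: contraNN uu' => Bu'; apply/eqP.
  move: uz uz' => /setD1P[_ uz] /setD1P[_ uz'].
  exact: (tangent_class_uniq zZ pz Bp uz uz').
have pF u : u \in tangent_class p z :\ z0 -> p \in u.
  by case/setD1P => _ /tangent_class_through; apply.
move=> B C BC; case: (eqVneq B p) => [Bp|Bp].
  have [|u uF Cu] := base C; first by rewrite -Bp eq_sym.
  by exists u; rewrite ?in_setU ?uF // Bp (pF u) // (negbTE Cu).
case: (eqVneq C p) => [Cp|Cp].
  have [|u uF Bu] := base B; first by rewrite -Cp.
  by exists u; rewrite ?in_setU ?uF // Cp (pF u) // (negbTE Bu).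
have [u uz Bu] := tangent_class_exists B zZ pz.
have [v vw Bv] := tangent_class_exists B wZ pw.
case Cu: (C \in u); last first.
  have [|x xF neq] := separate z z0 B C zZ pz Bp Cp.
    by exists u; rewrite // Bu Cu.
  by exists x; rewrite // in_setU xF.
case Cv: (C \in v); last first.
  have [|x xF neq] := separate w w0 B C wZ pw Bp Cp.
    by exists v; rewrite // Bv Cv.
  by exists x; rewrite // in_setU xF orbT.
have uZ : u \in Z by move: uz; rewrite inE => /andP[].
have vZ : v \in Z by move: vw; rewrite inE => /andP[].
have pu := tangent_class_through uz pz; have pv := tangent_class_through vw pw.
(* Equal coordinates put [p], [B] and [C] on both [u] and [v]. The two classes then coincide, and
   [z] and [w] are parallel circles that share [A], contradicting [zw]. *)
have uv : u = v.
  by apply: (circle_uniq uZ vZ Bp BC _ Bu pu Cu Bv pv Cv); rewrite eq_sym.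
rewrite -uv in vw.
case/eqP: zw; apply: (tangent_class_uniq uZ pu Ap) => //; exact: tangent_class_sym.
Qed.

Lemma exists_circles_resolve : exists F : {set {set P}},
  [/\ F \subset Z, circles_resolve F & #|F| <= 2 * q - 2 + (q == 2)].
Proof.
have [z zZ] := mobius_has_circle hMP.
have : 1 < #|z| by rewrite card_circle // ltnW // ltnS order_gt1.
case/card_gt1P => p [A [pz Az pA]].
have [B Bz] := mobius_off_circle hMP zZ.
have pB : p != B by apply: contraNneq Bz => <-.
have AB : A != B by apply: contraNneq Bz => <-.
have [w [wZ pw Aw Bw]] := exists_circle3 pA pB AB.
have zw : z != w by apply: contraNneq Bz => ->.
have zz : z \in tangent_class p z by rewrite inE zZ eqxx.
have ww : w \in tangent_class p w by rewrite inE wZ eqxx.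
have s0 : set0 \notin tangent_class p z.
  by apply/negP => /tangent_class_through/(_ pz); rewrite inE.
have sub v u : tangent_class p v :\ u \subset Z.
  by apply/subsetP => x; rewrite !inE => /and3P[].
(* For [q = 2] removing [z] would leave one member where two are required. Removing [set0], which is
   not in the class, keeps it whole at the cost of one circle. *)
pose z0 := if q == 2 then set0 else z.
have q1 := order_gt1.
have cz : #|tangent_class p z :\ z0| = q - 1 + (q == 2).
  have := cardsD1 z0 (tangent_class p z); rewrite card_tangent_class //.
  rewrite /z0; case: eqP => _; rewrite ?(negbTE s0) ?zz.
    by move: (#|_|) => m; clear -q1; lia.
  by move: (#|_|) => m; clear -q1; lia.
have cw : #|tangent_class p w :\ w| = q - 1.
  have := cardsD1 w (tangent_class p w); rewrite card_tangent_class // ww.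
  by move: (#|_|) => m; clear -q1; lia.
exists ((tangent_class p z :\ z0) :|: (tangent_class p w :\ w)); split.
- by rewrite subUset !sub.
- rewrite eq_sym in pA.
  apply: (coordinates_resolve _ zZ wZ pz pw zw pA Az Aw).
  by rewrite cz; clear -q1; case: eqP; lia.
- by rewrite (leq_trans (leq_card_setU _ _)) // cz cw; clear -q1; lia.
Qed.

End Mobius.

(** * Counting distinct traces *)

Lemma sum_powerset_sub (T : finType) (X : {set T}) (c : nat) :
  \sum_(Y in powerset X) (c - #|Y|) <= \sum_(i < c) (c - i) * 'C(#|X|, i).
Proof.
(* The right side groups the subsets of [X] by size; truncated subtraction makes those of size at
   least [c] contribute 0. *)
under [leqRHS]eq_bigr => i _ do
  rewrite -cards_draws mulnC -sum_nat_cond_const big_mkcond /=.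
rewrite exchange_big /= [leqLHS]big_mkcond /=.
apply: leq_sum => Y _; case: ifP => // YX.
case: (ltnP #|Y| c) => [Yc|]; last by rewrite -subn_eq0 => /eqP->.
rewrite (bigD1 (Ordinal Yc)) //= -powersetE YX eqxx.
exact: leq_addr.
Qed.

(* An i in A with fewer than c neighbours in X is charged to its trace. *)
Lemma distinct_traces_count (I J : finType) (A : {set I}) (X : {set J})
    (r : I -> J -> bool) (c : nat) :
  {in A &, injective (fun i => [set j in X | r i j])} ->
  c * #|A| <= \sum_(j in X) #|[set i in A | r i j]| +
              \sum_(i < c) (c - i) * 'C(#|X|, i).
Proof.
move=> inj; rewrite mulnC -sum_nat_const -double_count.
apply: leq_trans (leq_add (leqnn _) (sum_powerset_sub X c)).
apply: (@leq_trans (\sum_(i in A)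
    (#|[set j in X | r i j]| + (c - #|[set j in X | r i j]|)))).
  by apply: leq_sum => i _; rewrite -leq_subLR.
rewrite big_split leq_add2l /= -(big_imset (fun Y : {set J} => c - #|Y|) inj) /=.
rewrite big_mkcond [leqRHS]big_mkcond; apply: leq_sum => Y _.
case: imsetP => // -[i _ ->]; rewrite powersetE ifT //.
by apply/subsetP => j; rewrite inE => /andP[].
Qed.

(** * Bounds for the point part and the circle part *)

Section Bounds.
Variables (P : finType) (Z : {set {set P}}) (q : nat).
Hypothesis hM : mobius_plane_of_order Z q.

Lemma circles_resolve_lb (F : {set {set P}}) :
  F \subset Z -> circles_resolve F -> 2 * q <= #|F| + 3.
Proof.
move=> FZ res.
have := @distinct_traces_count _ _ [set: P] F (fun p z => p \in z) 2.
rewrite (eq_bigr (fun=> q.+1)); last first.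
  move=> z /(subsetP FZ) zZ; rewrite -(hM.2 z zZ).
  by apply: eq_card => p; rewrite !inE.
rewrite sum_nat_const cardsT (card_points hM) !big_ord_recl big_ord0 /= bin0 bin1.
(* Since [2 q^2 = (2 q - 4) (q + 2) + 8], the inequality forces [#|F| > 2 q - 4]. *)
move=> h; suff : 2 * (q ^ 2 + 1) <= #|F| * q.+1 + (2 + #|F|).
  by move: #|F| => n; clear; nia.
apply: leq_trans (h _) _; last by rewrite /bump /=; lia.
move=> p p' _ _ /setP eq_tr; apply/eqP; apply/negPn/negP => /res[z zF].
by have := eq_tr z; rewrite !inE zF /= => ->; rewrite eqxx.
Qed.

Lemma points_resolve_lb (A : {set P}) : points_resolve Z A -> 3 * q <= #|A| + 7.
Proof.
move=> res.
have := @distinct_traces_count _ _ Z A (fun z p => p \in z) 3.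
rewrite (eq_bigr (fun=> q * q.+1)); last by move=> p _; apply: card_circles_through.
rewrite sum_nat_const (card_circles hM) !big_ord_recl big_ord0 /= bin0 bin1 bin2.
move=> h; suff : 3 * (q * (q ^ 2 + 1)) <=
    #|A| * (q * q.+1) + (3 + 2 * #|A| + (#|A| * #|A|.-1)./2).
  have : (#|A| * #|A|.-1)./2 * 2 <= #|A| * #|A|.-1 by lia.
  move: (_./2) => s; move: #|A| => n; clear.
  case: (leqP (3 * q) (n + 7)) => // lt_n le_s le_q.
  exfalso.
  (* At [n = 3 q - 8] the upper bound is at most [3 q^3 - (q^2 + 55 q - 46) / 2], below
     [3 q^3 + 3 q], and it only decreases for smaller [n]. The slack [k] avoids natural
     subtraction. *)
  have [k eq_q] : exists k, 3 * q = n + 8 + k by exists (3 * q - (n + 8)); lia.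
  by nia.
apply: leq_trans (h _) _; last by rewrite /bump /=; lia.
move=> z w zZ wZ /setP eq_tr; apply/eqP; apply/negPn/negP => /(res z w zZ wZ)[p pA].
by have := eq_tr p; rewrite !inE pA /= => ->; rewrite eqxx.
Qed.

Local Open Scope ring_scope.

Lemma exists_points_resolve (R : realType) : (2 < q)%N ->
  exists2 A : {set P}, points_resolve Z A &
    #|A|%:R <= (q%:R + 2) / 2 * (1 + ln (q%:R ^+ 5)) :> R.
Proof.
move=> q2.
pose sd (e : {set P} * {set P}) := (e.1 :\: e.2) :|: (e.2 :\: e.1).
have in_sd x e : (x \in sd e) = ((x \in e.1) != (x \in e.2)).
  by rewrite !inE; case: (x \in e.1); case: (x \in e.2).
have sdC z w : sd (z, w) = sd (w, z) by rewrite /sd setUC.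
pose E := sd @: [set e in setX Z Z | e.1 != e.2].
have hk e : e \in E -> (2 * q - 2 <= #|e|)%N.
  case/imsetP => -[z w]; rewrite !inE /= => /andP[/andP[zZ wZ] zw] ->.
  have := card_circleI hM zZ wZ zw.
  have := cardsID w z; have := cardsID z w; rewrite setIC.
  rewrite (hM.2 z zZ) (hM.2 w wZ) /sd /= cardsU.
  rewrite (_ : (z :\: w) :&: (w :\: z) = set0) ?cards0; last first.
    by apply/setP => x; rewrite !inE; case: (x \in z); rewrite ?andbF.
  by move: (#|_|) (#|_|) (#|_|) => a b c; clear; lia.
have hd x : (#|[set e in E | x \in e]| <= q ^ 5)%N.
  pose Zx := [set z in Z | x \in z].
  have cZx : #|Zx| = (q * q.+1)%N := card_circles_through hM x.
  have sZx : Zx \subset Z by apply/subsetP => z; rewrite inE => /andP[].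
  (* A symmetric difference contains [x] only if exactly one of its two circles does; by [sdC] that
     circle can be put first. This leaves [q (q + 1) * q^2 (q - 1) = q^5 - q^3] pairs. *)
  apply: (@leq_trans #|sd @: setX Zx (Z :\: Zx)|).
    apply/subset_leq_card/subsetP => e; rewrite inE => /andP[/imsetP[[z w]]].
    rewrite !inE /= => /andP[/andP[zZ wZ] zw] -> /=; rewrite in_sd /=.
    case xz: (x \in z); case xw: (x \in w) => // _.
      by apply/imsetP; exists (z, w); rewrite // !inE zZ wZ xz xw.
    by rewrite sdC; apply/imsetP; exists (w, z); rewrite // !inE zZ wZ xz xw.
  apply: leq_trans (leq_imset_card _ _) _; rewrite cardsX.
  rewrite cardsD (setIidPr sZx) cZx (card_circles hM).
  have -> : (q * (q ^ 2 + 1) - q * q.+1 = q ^ 2 * (q - 1))%N.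
    by clear -q2; case: q q2 => // n _; nia.
  have -> : (q ^ 5 = q * q ^ 2 * q ^ 2)%N by rewrite -mulnA -expnD -expnS.
  rewrite mulnACA; clear -q2; case: q q2 => // n _; rewrite subn1 /=.
  by nia.
have k0 : (0 < 2 * q - 2)%N by clear -q2; lia.
have d0 : (0 < q ^ 5)%N by rewrite expn_gt0; clear -q2; lia.
have [A hA leA] := greedy_cover R k0 d0 hk hd.
exists A.
  move=> z w zZ wZ zw; have [|a aA az] := hA (sd (z, w)).
    by apply: imset_f; rewrite !inE zZ wZ.
  by exists a; rewrite // -(in_sd a (z, w)).
apply: le_trans leA _.
have K0 : 0 < (2 * q - 2)%N%:R :> R by rewrite ltr0n.
have D0 : 0 < (q ^ 5)%N%:R :> R by rewrite ltr0n.
have h1 : #|E|%:R / (q ^ 5)%N%:R <= #|P|%:R / (2 * q - 2)%N%:R :> R.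
  rewrite ler_pdivrMr // mulrAC ler_pdivlMr // -!natrM ler_nat.
  exact: cover_edges_le.
(* This amounts to [q^2 + 1 <= (q + 2) (q - 1)], that is, [q >= 3]. *)
have h2 : #|P|%:R / (2 * q - 2)%N%:R <= (q%:R + 2) / 2 :> R.
  rewrite ler_pdivrMr // mulrAC ler_pdivlMr // -natrD -!natrM ler_nat.
  by rewrite (card_points hM); clear -q2; nia.
rewrite -natrX mulrDr mulr1; apply: lerD; first exact: le_trans h1 h2.
by apply: ler_wpM2r => //; rewrite ln_ge0 // ler1n.
Qed.

End Bounds.

(** * From distances to incidence *)

Lemma gdist_eq (T : finType) (e : rel T) (u v : T) (n : nat) : n < #|T| ->
  (exists p : n.-tuple T, path e u p && (last u p == v)) ->
  (forall m (p : m.-tuple T), m < n -> path e u p -> last u p != v) ->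
  gdist e u v = n.
Proof.
(* Each length in [iota 0 #|T|] is its own position, so the search has to fail on the first [n]
   entries and succeed on the next one, which exists because [n < #|T|]. *)
move=> nT ex_n min_n; rewrite /gdist -(subnKC (ltnW nT)) iotaD find_cat.
have -> : #|T| - n = (#|T| - n).-1.+1 by rewrite prednK // subn_gt0.
rewrite ifF /= ?size_iota ?add0n.
  by rewrite (introT existsP ex_n) addn0.
apply/negP => /hasP[m]; rewrite mem_iota => /andP[_ ltmn] /existsP[p /andP[pp]].
by apply/negP/min_n.
Qed.

Section Incidence.
Variables (P : finType) (Z : {set {set P}}) (q : nat).
Hypothesis hM : mobius_plane_of_order Z q.

Definition is_point (u : vertex Z) : bool := if u is inl _ then true else false.

Lemma incidence_bipartite (u v : vertex Z) :
  incidence u v -> is_point v = ~~ is_point u.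
Proof. by case: u v => [?|?] [?|?]. Qed.

(** For a point off a circle, choose any point of that circle and join the two points by a second
    circle. *)
Lemma incidence_walk3 (u v : vertex Z) : is_point v = ~~ is_point u ->
  ~~ incidence u v ->
  exists x y, [/\ incidence u x, incidence x y & incidence y v].
Proof.
have walk (A : P) (c : {z | z \in Z}) : A \notin val c ->
    exists (w : {z | z \in Z}) B, [/\ A \in val w, B \in val w & B \in val c].
  move=> Ac.
  have /card_gt0P[B Bc] : 0 < #|val c| by rewrite (hM.2 _ (valP c)).
  have AB : A != B by apply: contraNneq Ac => ->.
  have [C /andP[CA CB]] := exists_third_point hM A B.
  rewrite eq_sym in CA; rewrite eq_sym in CB.
  have [w [wZ Aw Bw _]] := exists_circle3 hM AB CA CB.
  by exists (exist _ w wZ), B.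
case: u v => [A|c] [B|d] //= _ /walk[w [C [h1 h2 h3]]].
  by exists (inr w), (inl C).
by exists (inl C), (inr w).
Qed.

Lemma gdist_incidence (u v : vertex Z) : is_point v = ~~ is_point u ->
  gdist (@incidence P Z) u v = if incidence u v then 1 else 3.
Proof.
move=> bip.
(* This keeps length 3 within the range searched by [gdist]. *)
have cardV : 3 < #|vertex Z|.
  rewrite card_sum (card_points hM); have := order_gt1 hM; clear.
  by move: (#|_|) => m; nia.
have neq : u != v by apply: contra_eqN bip => /eqP->; case: (is_point v).
case: ifP => [uv|/negbT uv].
  apply: gdist_eq; first by apply: leq_trans cardV.
    by exists [tuple v]; rewrite /= uv eqxx.
  by move=> [|//] p _ _; rewrite tuple0.
apply: gdist_eq => //.
  have [x [y [ux xy yv]]] := incidence_walk3 bip uv.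
  by exists [tuple x; y; v]; rewrite /= ux xy yv eqxx.
(* Length 0 is excluded by [neq], length 1 by non-incidence, and length 2 because the graph is
   bipartite. *)
case=> [|[|[|//]]] [[|x [|y [|]]] //= sz] _.
  by rewrite andbT => ux; apply: contraNneq uv => <-.
rewrite andbT => /andP[/incidence_bipartite ex /incidence_bipartite ey].
by apply: contra_eqN bip => /eqP <-; rewrite ey ex negbK; case: is_point.
Qed.

Lemma gdist_incidence_neq (u v s : vertex Z) :
  is_point s = ~~ is_point u -> is_point s = ~~ is_point v ->
  (gdist (@incidence P Z) u s != gdist (@incidence P Z) v s) =
  (incidence u s != incidence v s).
Proof. by move=> us vs; rewrite !gdist_incidence //; do 2!case: ifP. Qed.

Definition points_of (S : {set vertex Z}) : {set P} := [set A | inl A \in S].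

Definition circles_of (S : {set vertex Z}) : {set {set P}} :=
  [set val c | c : {z | z \in Z} & inr c \in S].

Lemma circles_of_sub S : circles_of S \subset Z.
Proof. by apply/subsetP => _ /imsetP[c _ ->]; apply: valP. Qed.

Lemma card_split (S : {set vertex Z}) : #|S| = #|points_of S| + #|circles_of S|.
Proof.
rewrite card_imset; last exact: val_inj.
by rewrite -sum1_card big_sumType /= !sum1dep_card.
Qed.

(** Only point-circle distances enter the definition, and these are 1 or 3 according to incidence.
    The two conditions are therefore independent, and the optimal parts can be sought separately. *)
Lemma split_resolvingP (S : {set vertex Z}) : split_resolving S <->
  points_resolve Z (points_of S) /\ circles_resolve (circles_of S).
Proof.
split=> -[resZ resP]; split.
- move=> z w zZ wZ zw.
  have [|||s] := resZ (inr (exist _ z zZ)) (inr (exist _ w wZ)); rewrite ?inE //.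
  case: s => [A|c]; rewrite ?andbF // andbT => AS.
  by rewrite gdist_incidence_neq //=; exists A; rewrite ?inE.
- move=> A B AB.
  have [|||s] := resP (inl A) (inl B); rewrite ?inE //.
  case: s => [C|c]; rewrite ?andbF // andbT => cS.
  rewrite gdist_incidence_neq //=; exists (val c) => //.
  by apply: imset_f; rewrite inE.
- move=> [A|c] [B|d]; rewrite !inE // => _ _ cd.
  have [a aS neq] := resZ (val c) (val d) (valP c) (valP d) cd.
  exists (inl a); first by move: aS; rewrite !inE andbT.
  by rewrite gdist_incidence_neq.
- move=> [A|c] [B|d]; rewrite !inE // => _ _ AB.
  have [_ /imsetP[c cS ->] neq] := resP A B AB.
  exists (inr c); first by move: cS; rewrite !inE andbT.
  by rewrite gdist_incidence_neq.
Qed.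

Definition join_vertices (A : {set P}) (F : {set {set P}}) : {set vertex Z} :=
  [set v : vertex Z | match v with inl a => a \in A | inr c => val c \in F end].

Lemma points_of_join A F : points_of (join_vertices A F) = A.
Proof. by apply/setP => a; rewrite !inE. Qed.

Lemma circles_of_join A (F : {set {set P}}) :
  F \subset Z -> circles_of (join_vertices A F) = F.
Proof.
move=> FZ; apply/setP => z; apply/imsetP/idP => [[c]|zF].
  by rewrite !inE => cF ->.
by exists (exist _ z (subsetP FZ z zF)); rewrite // !inE.
Qed.

Lemma min_split_resolving_le (S : {set vertex Z}) A (F : {set {set P}}) :
  min_split_resolving S ->
  points_resolve Z A -> F \subset Z -> circles_resolve F -> #|S| <= #|A| + #|F|.
Proof.
move=> [_ minS] resA FZ resF; have := minS (join_vertices A F).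
rewrite (card_split (join_vertices A F)) points_of_join circles_of_join //; apply.
by apply/split_resolvingP; rewrite points_of_join circles_of_join.
Qed.

End Incidence.

Lemma ln2_ge_half (R : realType) : (2^-1 <= ln 2 :> R)%R.
Proof. by have := @ln_succ_diff R 1 isT; rewrite ln1 subr0. Qed.

Local Open Scope ring_scope.

Theorem mainTheorem7 (R : realType) (P : finType) (Z : {set {set P}}) (q : nat)
    (hM : mobius_plane_of_order Z q) (S : {set vertex Z})
    (hS : min_split_resolving S) :
  5 * q%:R - 10 <= #|S|%:R :> R /\
  #|S|%:R <= (q%:R + 2) / 2 * (1 + ln (q%:R ^+ 5)) + 2 * q%:R - 2 :> R.
Proof.
split.
  have [resZ resP] := (split_resolvingP hM S).1 hS.1.
  (* The two lower bounds add up to [(3 q - 7) + (2 q - 3) = 5 q - 10]. *)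
  have := circles_resolve_lb hM (circles_of_sub S) resP.
  have := points_resolve_lb hM resZ; have := card_split S.
  move: #|_| #|_| #|_| => n c s; rewrite lerBlDr -natrD -natrM ler_nat; lia.
have [F [FZ resF leF]] := exists_circles_resolve hM.
have q1 := order_gt1 hM.
case: (ltngtP 2 q) => [q2|q2|q2]; [| by lia |].
  have [A resA leA] := exists_points_resolve hM R q2.
  have := min_split_resolving_le hM hS resA FZ resF.
  rewrite (gtn_eqF q2) addn0 in leF => leS.
  apply: (@le_trans _ _ (#|A|%:R + (2 * q - 2)%:R)).
    by rewrite -natrD ler_nat (leq_trans leS) ?leq_add2l.
  rewrite natrB; last by lia.
  by rewrite natrM -addrA lerD2r.
(* From here [q = 2], where the greedy estimate is replaced by taking all points. *)
have resT : points_resolve Z [set: P].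
  move=> z w _ _; case: (pickP (fun a => (a \in z) != (a \in w))) => [a ? _|eq_zw].
    by exists a.
  by case/eqP; apply/setP => a; apply/eqP/negbFE/eq_zw.
have := min_split_resolving_le hM hS resT FZ resF.
rewrite cardsT (card_points hM) => leS; subst q.
have leS8 : (#|S| <= 8)%N by lia.
(* For [q = 2] the claimed bound is [4 + 10 ln 2], at least 9 by [ln 2 >= 1/2], while
   [#|S| <= 5 + 3]. *)
have := ln2_ge_half R; rewrite lnXn //; move: leS8; rewrite -(ler_nat R).
by rewrite -mulr_natr; lra.
Qed.
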